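(* Let $\mathbb{X}$ be a semi-abelian category. The following conditions are equivalent: (i) for any weighted cospan $(x,y,w)$ in $\mathbb{X}$, the morphisms $x$ and $y$ commute over $w$ as soon as they Huq-commute; (ii) for any given cospan $(x,y)$ in $\mathbb{X}$, the property of commuting over $w$ is independent of the chosen weight $w$ making $(x,y,w)$ a weighted cospan in $\mathbb{X}$; that is, for any two weights $w$, $w'$, the morphisms $x$ and $y$ commute over $w$ if and only if they commute over $w'$; (iii) for any given weighted cospan $(x,y,w)$ in $\mathbb{X}$, if $[\mathrm{Im}(x),\mathrm{Im}(y)]=0$ then $[\mathrm{Im}(x),\mathrm{Im}(y),\mathrm{Im}(w)]=0$; (iv) any of the conditions (i), (ii), (iii), restricted to cospans $(x,y)$ of monomorphisms (each of these three restricted conditions is equivalent to the others).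
   Context: A semi-abelian category is a pointed, Barr exact, Bourn protomodular category with binary coproducts. For morphisms $u\colon U\to D$, $v\colon V\to D$ (and $t\colon T\to D$), $\langle u;v\rangle\colon U+V\to D$ (and $\langle u;v;t\rangle\colon U+V+T\to D$) denotes the induced morphism out of the coproduct. $\mathrm{Im}$ denotes the regular image. Morphisms $x\colon X\to D$ and $y\colon Y\to D$ Huq-commute if there is $\varphi\colon X\times Y\to D$ with $\varphi\circ\langle1_X,0\rangle=x$ and $\varphi\circ\langle0,1_Y\rangle=y$. A cospan $(x,y)$ is a pair of morphisms $x\colon X\to D$, $y\colon Y\to D$ with common codomain. A weighted cospan $(x,y,w)$ consists of morphisms $x\colon X\to D$, $y\colon Y\to D$, $w\colon W\to D$ with common codomain; $w$ is called the weight. The morphisms $x$ and $y$ commute over $w$ if there is a morphism $\varphi\colon (W+X)\times_W(W+Y)\to D$ such that $\varphi\circ e_1=\langle w;x\rangle$ and $\varphi\circ e_2=\langle w;y\rangle$. Here the pullback is that of $f=\langle 1_W;0\rangle\colon W+X\to W$ and $g=\langle 1_W;0\rangle\colon W+Y\to W$; writing $r\colon W\to W+X$, $s\colon W\to W+Y$ for the coproduct inclusions, $e_1=\langle 1_{W+X},s\circ f\rangle$ and $e_2=\langle r\circ g,1_{W+Y}\rangle$. Higgins commutators: for subobjects $k\colon K\to D$, $l\colon L\to D$, $m\colon M\to D$, let $K\diamond L$ be the kernel of the canonical morphism $K+L\to K\times L$ and let $[K,L]\leq D$ be the image of the composite $K\diamond L\to K+L\xrightarrow{\langle k;l\rangle}D$.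 Let $K\diamond L\diamond M$ be the kernel of the canonical morphism $K+L+M\to(K+L)\times(K+M)\times(L+M)$ (whose components send the missing summand to $0$ and are the coproduct inclusions on the other two) and let $[K,L,M]\leq D$ be the image of the composite $K\diamond L\diamond M\to K+L+M\xrightarrow{\langle k;l;m\rangle}D$. *)

(* Defs.v *)
Set Implicit Arguments.
Unset Strict Implicit.
Unset Printing Implicit Defensive.

Declare Scope cat_scope.
Open Scope cat_scope.

Record Category := {
  Ob :> Type;
  Hom : Ob -> Ob -> Type;
  id : forall A, Hom A A;
  comp : forall A B D, Hom B D -> Hom A B -> Hom A D;
  comp_id_l : forall A B (f : Hom A B), comp (id B) f = f;
  comp_id_r : forall A B (f : Hom A B), comp f (id A) = f;
  comp_assoc : forall A B D E (h : Hom D E) (g : Hom B D) (f : Hom A B),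
    comp h (comp g f) = comp (comp h g) f
}.

Arguments Hom {_} _ _.
Arguments id {_} _.
Notation "g ∘ f" := (comp g f) (at level 40, left associativity) : cat_scope.

(* Universal constructions carry their mediating morphisms as data, so that
   they can be used without choice. *)

Record ZeroObject (C : Category) := {
  zero_ob : C;
  to_zero : forall A, Hom A zero_ob;
  to_zero_uniq : forall A (f : Hom A zero_ob), f = to_zero A;
  from_zero : forall A, Hom zero_ob A;
  from_zero_uniq : forall A (f : Hom zero_ob A), f = from_zero A
}.

Record Product (C : Category) (A B : C) := {
  prod_ob : C;
  prod_fst : Hom prod_ob A;
  prod_snd : Hom prod_ob B;
  prod_pair : forall X, Hom X A -> Hom X B -> Hom X prod_ob;
  prod_pair_fst : forall X (u : Hom X A) (v : Hom X B),
    prod_fst ∘ prod_pair u v = u;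
  prod_pair_snd : forall X (u : Hom X A) (v : Hom X B),
    prod_snd ∘ prod_pair u v = v;
  prod_pair_uniq : forall X (u : Hom X A) (v : Hom X B) (h : Hom X prod_ob),
    prod_fst ∘ h = u -> prod_snd ∘ h = v -> h = prod_pair u v
}.

Record Coproduct (C : Category) (A B : C) := {
  coprod_ob : C;
  coprod_inl : Hom A coprod_ob;
  coprod_inr : Hom B coprod_ob;
  coprod_copair : forall X, Hom A X -> Hom B X -> Hom coprod_ob X;
  coprod_copair_inl : forall X (u : Hom A X) (v : Hom B X),
    coprod_copair u v ∘ coprod_inl = u;
  coprod_copair_inr : forall X (u : Hom A X) (v : Hom B X),
    coprod_copair u v ∘ coprod_inr = v;
  coprod_copair_uniq : forall X (u : Hom A X) (v : Hom B X)
      (h : Hom coprod_ob X),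
    h ∘ coprod_inl = u -> h ∘ coprod_inr = v -> h = coprod_copair u v
}.

Record Pullback (C : Category) (A B D : C) (f : Hom A D) (g : Hom B D) := {
  pb_ob : C;
  pb_fst : Hom pb_ob A;
  pb_snd : Hom pb_ob B;
  pb_square : f ∘ pb_fst = g ∘ pb_snd;
  pb_pair : forall X (u : Hom X A) (v : Hom X B), f ∘ u = g ∘ v -> Hom X pb_ob;
  pb_pair_fst : forall X (u : Hom X A) (v : Hom X B) (e : f ∘ u = g ∘ v),
    pb_fst ∘ pb_pair e = u;
  pb_pair_snd : forall X (u : Hom X A) (v : Hom X B) (e : f ∘ u = g ∘ v),
    pb_snd ∘ pb_pair e = v;
  pb_pair_uniq : forall X (u : Hom X A) (v : Hom X B) (e : f ∘ u = g ∘ v)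
      (h : Hom X pb_ob),
    pb_fst ∘ h = u -> pb_snd ∘ h = v -> h = pb_pair e
}.

Record Coequalizer (C : Category) (Z A : C) (f g : Hom Z A) := {
  coeq_ob : C;
  coeq_map : Hom A coeq_ob;
  coeq_eq : coeq_map ∘ f = coeq_map ∘ g;
  coeq_desc : forall X (h : Hom A X), h ∘ f = h ∘ g -> Hom coeq_ob X;
  coeq_desc_map : forall X (h : Hom A X) (e : h ∘ f = h ∘ g),
    coeq_desc e ∘ coeq_map = h;
  coeq_desc_uniq : forall X (h : Hom A X) (e : h ∘ f = h ∘ g)
      (k : Hom coeq_ob X),
    k ∘ coeq_map = h -> k = coeq_desc e
}.

Section Predicates.
Variable C : Category.

Definition is_mono (A B : C) (m : Hom A B) : Prop :=
  forall (X : C) (u v : Hom X A), m ∘ u = m ∘ v -> u = v.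

Definition is_iso (A B : C) (f : Hom A B) : Prop :=
  exists g : Hom B A, g ∘ f = id A /\ f ∘ g = id B.

Definition is_coequalizer (Z A Q : C) (f g : Hom Z A) (q : Hom A Q) : Prop :=
  q ∘ f = q ∘ g /\
  forall (X : C) (h : Hom A X), h ∘ f = h ∘ g -> exists! k : Hom Q X, k ∘ q = h.

Definition is_regular_epi (A Q : C) (q : Hom A Q) : Prop :=
  exists (Z : C) (f g : Hom Z A), is_coequalizer f g q.

Definition is_kernel_pair (R A B : C) (r1 r2 : Hom R A) (q : Hom A B) : Prop :=
  q ∘ r1 = q ∘ r2 /\
  forall (X : C) (u v : Hom X A), q ∘ u = q ∘ v ->
    exists! h : Hom X R, r1 ∘ h = u /\ r2 ∘ h = v.

Definition is_equivalence_relation (R A : C) (r1 r2 : Hom R A) : Prop :=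
  (forall (X : C) (u v : Hom X R),
     r1 ∘ u = r1 ∘ v -> r2 ∘ u = r2 ∘ v -> u = v) /\
  (exists d : Hom A R, r1 ∘ d = id A /\ r2 ∘ d = id A) /\
  (exists s : Hom R R, r1 ∘ s = r2 /\ r2 ∘ s = r1) /\
  (forall P : Pullback r2 r1, exists t : Hom (pb_ob P) R,
     r1 ∘ t = r1 ∘ pb_fst P /\ r2 ∘ t = r2 ∘ pb_snd P).

Definition regular_epis_pullback_stable : Prop :=
  forall (A B E : C) (q : Hom A B) (p : Hom E B) (P : Pullback q p),
    is_regular_epi q -> is_regular_epi (pb_snd P).

Definition equivalence_relations_effective : Prop :=
  forall (R A : C) (r1 r2 : Hom R A), is_equivalence_relation r1 r2 ->
    exists (B : C) (q : Hom A B), is_kernel_pair r1 r2 q.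

(* For every p : E -> B, the change-of-base functor p^* : Pt_B -> Pt_E between
   categories of points (split epimorphisms with a chosen section) reflects
   isomorphisms; h' below is p^*(h). *)
Definition protomodular : Prop :=
  forall (E B A A' : C) (p : Hom E B)
    (f : Hom A B) (s : Hom B A) (f' : Hom A' B) (s' : Hom B A') (h : Hom A A'),
    f ∘ s = id B -> f' ∘ s' = id B -> f' ∘ h = f -> h ∘ s = s' ->
    forall (P : Pullback p f) (P' : Pullback p f')
      (h' : Hom (pb_ob P) (pb_ob P')),
    pb_fst P' ∘ h' = pb_fst P -> pb_snd P' ∘ h' = h ∘ pb_snd P ->
    is_iso h' -> is_iso h.

(* Equality of the subobjects of D represented by m and n. *)
Definition same_subobject (A B D : C) (m : Hom A D) (n : Hom B D) : Prop :=
  exists h : Hom A B, is_iso h /\ n ∘ h = m.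

End Predicates.

(* Finite limits are given by the zero object, products and pullbacks; with
   the coequalizers of kernel pairs and the next two fields, the category is
   Barr exact. *)
Record SemiAbelianCategory := {
  sa_cat :> Category;
  zero_object : ZeroObject sa_cat;
  product : forall A B : sa_cat, Product A B;
  pullback : forall (A B D : sa_cat) (f : Hom A D) (g : Hom B D), Pullback f g;
  kernel_pair_coequalizer : forall (A B : sa_cat) (f : Hom A B),
    Coequalizer (pb_fst (pullback f f)) (pb_snd (pullback f f));
  regular_epis_stable : regular_epis_pullback_stable sa_cat;
  effective : equivalence_relations_effective sa_cat;
  bourn_protomodular : protomodular sa_cat;
  coproduct : forall A B : sa_cat, Coproduct A B
}.

Section SemiAbelian.
Variable C : SemiAbelianCategory.

Definition zob : C := zero_ob (zero_object C).
Definition zero (A B : C) : Hom A B :=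
  from_zero (zero_object C) B ∘ to_zero (zero_object C) A.

Definition prod (A B : C) : C := prod_ob (product A B).
Definition pair (X A B : C) (u : Hom X A) (v : Hom X B) : Hom X (prod A B) :=
  prod_pair (product A B) u v.

Definition coprod (A B : C) : C := coprod_ob (coproduct A B).
Definition inl (A B : C) : Hom A (coprod A B) := coprod_inl (coproduct A B).
Definition inr (A B : C) : Hom B (coprod A B) := coprod_inr (coproduct A B).
Definition copair (A B X : C) (u : Hom A X) (v : Hom B X) :
    Hom (coprod A B) X :=
  coprod_copair (coproduct A B) u v.

Definition coprod3 (A B D : C) : C := coprod (coprod A B) D.
Definition copair3 (A B D X : C) (u : Hom A X) (v : Hom B X) (t : Hom D X) :
    Hom (coprod3 A B D) X :=
  copair (copair u v) t.

Definition ker_ob (A B : C) (f : Hom A B) : C := pb_ob (pullback f (zero zob B)).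
Definition ker (A B : C) (f : Hom A B) : Hom (ker_ob f) A :=
  pb_fst (pullback f (zero zob B)).

(* The regular image of f: f factors through the coequalizer of its kernel
   pair, and im f is the second factor. *)
Definition im_ob (A B : C) (f : Hom A B) : C :=
  coeq_ob (kernel_pair_coequalizer f).
Definition im (A B : C) (f : Hom A B) : Hom (im_ob f) B :=
  coeq_desc (kernel_pair_coequalizer f) (pb_square (pullback f f)).

Definition huq_commute (X Y D : C) (x : Hom X D) (y : Hom Y D) : Prop :=
  exists phi : Hom (prod X Y) D,
    phi ∘ pair (id X) (zero X Y) = x /\ phi ∘ pair (zero Y X) (id Y) = y.

Section Weighted.
Variables W X Y : C.

Definition retr (Z : C) : Hom (coprod W Z) W := copair (id W) (zero Z W).

Definition weighted_pb : Pullback (retr X) (retr Y) :=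
  pullback (retr X) (retr Y).

Lemma retr_inl (Z : C) : retr Z ∘ inl W Z = id W.
Proof. exact (coprod_copair_inl _ _ _). Qed.

Lemma weighted_e1_eq :
  retr X ∘ id (coprod W X) = retr Y ∘ (inl W Y ∘ retr X).
Proof. now rewrite comp_assoc, retr_inl, comp_id_l, comp_id_r. Qed.

Lemma weighted_e2_eq :
  retr X ∘ (inl W X ∘ retr Y) = retr Y ∘ id (coprod W Y).
Proof. now rewrite comp_assoc, retr_inl, comp_id_l, comp_id_r. Qed.

Definition weighted_e1 : Hom (coprod W X) (pb_ob weighted_pb) :=
  pb_pair weighted_pb weighted_e1_eq.
Definition weighted_e2 : Hom (coprod W Y) (pb_ob weighted_pb) :=
  pb_pair weighted_pb weighted_e2_eq.

Definition commute_over (D : C) (x : Hom X D) (y : Hom Y D) (w : Hom W D) :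
    Prop :=
  exists phi : Hom (pb_ob weighted_pb) D,
    phi ∘ weighted_e1 = copair w x /\ phi ∘ weighted_e2 = copair w y.

End Weighted.

Definition cross2_map (K L : C) : Hom (coprod K L) (prod K L) :=
  pair (copair (id K) (zero L K)) (copair (zero K L) (id L)).

Definition higgins2 (K L D : C) (k : Hom K D) (l : Hom L D) :=
  im (copair k l ∘ ker (cross2_map K L)).

Definition cross3_map (K L M : C) :
    Hom (coprod3 K L M) (prod (prod (coprod K L) (coprod K M)) (coprod L M)) :=
  pair
    (pair (copair3 (inl K L) (inr K L) (zero M (coprod K L)))
          (copair3 (inl K M) (zero L (coprod K M)) (inr K M)))
    (copair3 (zero K (coprod L M)) (inl L M) (inr L M)).

Definition higgins3 (K L M D : C) (k : Hom K D) (l : Hom L D) (m : Hom M D) :=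
  im (copair3 k l m ∘ ker (cross3_map K L M)).

Definition is_zero_subobject (A D : C) (m : Hom A D) : Prop :=
  same_subobject m (zero zob D).

Definition cospan_class : Type :=
  forall X Y D : C, Hom X D -> Hom Y D -> Prop.

Definition all_cospans : cospan_class := fun _ _ _ _ _ => True.
Definition mono_cospans : cospan_class :=
  fun _ _ _ x y => is_mono x /\ is_mono y.

Definition huq_implies_commute_over (P : cospan_class) : Prop :=
  forall (X Y W D : C) (x : Hom X D) (y : Hom Y D) (w : Hom W D),
    P X Y D x y -> huq_commute x y -> commute_over x y w.

Definition commute_over_weight_independent (P : cospan_class) : Prop :=
  forall (X Y D : C) (x : Hom X D) (y : Hom Y D), P X Y D x y ->
    forall (W W' : C) (w : Hom W D) (w' : Hom W' D),
      commute_over x y w <-> commute_over x y w'.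

Definition binary_zero_implies_ternary_zero (P : cospan_class) : Prop :=
  forall (X Y W D : C) (x : Hom X D) (y : Hom Y D) (w : Hom W D),
    P X Y D x y ->
    is_zero_subobject (higgins2 (im x) (im y)) ->
    is_zero_subobject (higgins3 (im x) (im y) (im w)).

End SemiAbelian.

Arguments all_cospans : clear implicits.
Arguments mono_cospans : clear implicits.

(* Main.v *)
From Stdlib Require Import Setoid.
Require Import Defs.

(** Everything rests on one description of weighted commutation
    ([commute_over_iff]): [x] and [y] commute over [w] exactly when they
    Huq-commute and, in addition, [<x;y;w>] vanishes on the ternary
    co-smash product [X <> Y <> W], the kernel of [cross3_map X Y W].

    The reason is as follows.  The canonical map
    [c : X + Y + W -> (W + X) x_W (W + Y)] is an extremal epimorphism, because
    by protomodularity its codomain is generated by the section [e1] of the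
    first projection and the kernel of that projection, which lies inside
    [e2].  In a semi-abelian category an extremal epimorphism is the cokernel
    of its kernel ([factors_through_extremal_epi]), so commuting over [w] means
    that [<x;y;w>] vanishes on [Ker c].  Now [Ker c] consists of what dies both
    on omitting [X] and on omitting [Y].  Omitting [W] sends it to the binary
    co-smash product [X <> Y], the inclusion of [X + Y] splits this map, and
    its kernel is [X <> Y <> W].  Protomodularity again says that [Ker c] is
    generated by [X <> Y] and [X <> Y <> W]; vanishing on the first is
    Huq-commutation, since [X + Y -> X x Y] is an extremal epimorphism too.

    Since [im g = 0] as a subobject iff [g = 0], the Higgins commutator
    conditions say the same things for the images of [x], [y] and [w]
    ([higgins2_zero], [higgins3_zero]).  The equivalences follow: the ternary
    condition is void for the weight [0 -> D], so independence of the weight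
    means that Huq-commutation alone suffices; and one may pass between
    morphisms and their images because Huq-commutation is both inherited by
    images and recovered from them ([huq_commute_im]), while the vanishing of
    [<x;y;w>] on the ternary co-smash product need only be recovered from
    images, where naturality suffices ([cross3_natural]). *)

Set Implicit Arguments.
Unset Strict Implicit.
Unset Printing Implicit Defensive.

Section SemiAbelianTheory.
Variable C : SemiAbelianCategory.

(** * Calculus of zero morphisms, sums, products and kernels *)

Lemma zero_comp (A B D : C) (f : Hom A B) : zero B D ∘ f = zero A D.
Proof.
  unfold zero; rewrite <- comp_assoc; f_equal; apply to_zero_uniq.
Qed.

Lemma comp_zero (A B D : C) (f : Hom B D) : f ∘ zero A B = zero A D.
Proof.
  unfold zero; rewrite comp_assoc; f_equal; apply from_zero_uniq.
Qed.

Lemma to_zob (A : C) (f g : Hom A (zob C)) : f = g.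
Proof. now rewrite (to_zero_uniq f), (to_zero_uniq g). Qed.

Lemma from_zob (A : C) (f g : Hom (zob C) A) : f = g.
Proof. now rewrite (from_zero_uniq f), (from_zero_uniq g). Qed.

Lemma copair_inl (A B X : C) (u : Hom A X) (v : Hom B X) :
  copair u v ∘ inl A B = u.
Proof. apply coprod_copair_inl. Qed.

Lemma copair_inr (A B X : C) (u : Hom A X) (v : Hom B X) :
  copair u v ∘ inr A B = v.
Proof. apply coprod_copair_inr. Qed.

Lemma copair_inl_comp (Z A B X : C) (u : Hom A X) (v : Hom B X) (h : Hom Z A) :
  copair u v ∘ (inl A B ∘ h) = u ∘ h.
Proof. now rewrite comp_assoc, copair_inl. Qed.

Lemma copair_inr_comp (Z A B X : C) (u : Hom A X) (v : Hom B X) (h : Hom Z B) :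
  copair u v ∘ (inr A B ∘ h) = v ∘ h.
Proof. now rewrite comp_assoc, copair_inr. Qed.

Lemma coprod_ext (A B X : C) (u v : Hom (coprod A B) X) :
  u ∘ inl A B = v ∘ inl A B -> u ∘ inr A B = v ∘ inr A B -> u = v.
Proof.
  intros el er.
  rewrite (coprod_copair_uniq el er); symmetry.
  now apply coprod_copair_uniq.
Qed.

Definition fst (A B : C) : Hom (prod A B) A := prod_fst (product A B).
Definition snd (A B : C) : Hom (prod A B) B := prod_snd (product A B).

Lemma fst_pair (X A B : C) (u : Hom X A) (v : Hom X B) :
  fst A B ∘ pair u v = u.
Proof. apply prod_pair_fst. Qed.

Lemma snd_pair (X A B : C) (u : Hom X A) (v : Hom X B) :
  snd A B ∘ pair u v = v.
Proof. apply prod_pair_snd. Qed.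

Lemma fst_pair_comp (Z X A B : C) (u : Hom X A) (v : Hom X B) (h : Hom Z X) :
  fst A B ∘ (pair u v ∘ h) = u ∘ h.
Proof. now rewrite comp_assoc, fst_pair. Qed.

Lemma snd_pair_comp (Z X A B : C) (u : Hom X A) (v : Hom X B) (h : Hom Z X) :
  snd A B ∘ (pair u v ∘ h) = v ∘ h.
Proof. now rewrite comp_assoc, snd_pair. Qed.

Lemma prod_ext (X A B : C) (u v : Hom X (prod A B)) :
  fst A B ∘ u = fst A B ∘ v -> snd A B ∘ u = snd A B ∘ v -> u = v.
Proof.
  intros el er.
  rewrite (prod_pair_uniq el er); symmetry.
  now apply prod_pair_uniq.
Qed.

Lemma pb_ext (A B D X : C) (f : Hom A D) (g : Hom B D) (P : Pullback f g)
    (u v : Hom X (pb_ob P)) :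
  pb_fst P ∘ u = pb_fst P ∘ v -> pb_snd P ∘ u = pb_snd P ∘ v -> u = v.
Proof.
  intros el er.
  assert (e : f ∘ (pb_fst P ∘ v) = g ∘ (pb_snd P ∘ v))
    by now rewrite !comp_assoc, pb_square.
  rewrite (pb_pair_uniq e el er); symmetry.
  now apply pb_pair_uniq.
Qed.

Hint Rewrite zero_comp comp_zero copair_inl copair_inr copair_inl_comp
  copair_inr_comp fst_pair snd_pair fst_pair_comp snd_pair_comp
  (@comp_id_l C) (@comp_id_r C) : cat.

Hint Rewrite <- (@comp_assoc C) : cat.
Ltac cat := unfold copair3, coprod3; autorewrite with cat.

Lemma pair_comp_zero (Z X A B : C) (u : Hom X A) (v : Hom X B) (k : Hom Z X) :
  pair u v ∘ k = zero Z (prod A B) <-> u ∘ k = zero Z A /\ v ∘ k = zero Z B.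
Proof.
  split.
  - intro e; split.
    + rewrite <- (fst_pair u v), <- comp_assoc, e; apply comp_zero.
    + rewrite <- (snd_pair u v), <- comp_assoc, e; apply comp_zero.
  - intros [eu ev]; apply prod_ext; cat; assumption.
Qed.

Lemma ker_comp (A B : C) (f : Hom A B) : f ∘ ker f = zero (ker_ob f) B.
Proof.
  exact (eq_trans (pb_square (pullback f (zero (zob C) B))) (zero_comp _ _)).
Qed.

Lemma ker_lift (Z A B : C) (f : Hom A B) (k : Hom Z A) :
  f ∘ k = zero Z B -> exists k' : Hom Z (ker_ob f), ker f ∘ k' = k.
Proof.
  intro e.
  assert (e' : f ∘ k = zero (zob C) B ∘ to_zero (zero_object C) Z)
    by now rewrite e, zero_comp.
  exists (pb_pair (pullback f (zero (zob C) B)) e'); apply pb_pair_fst.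
Qed.

Lemma ker_mono (A B : C) (f : Hom A B) : is_mono (ker f).
Proof.
  intros X u v e; apply pb_ext; [exact e | apply to_zob].
Qed.

(** * Protomodularity: a split epimorphism is generated by section and kernel *)

(** A monomorphism [m] through which [s] and the kernel of [f] factor is a
    morphism of points whose pullback along [0 -> B] compares the kernels of
    [f ∘ m] and [f]; the comparison is invertible, hence so is [m]. *)
Lemma split_point_generated (A B M : C) (f : Hom A B) (s : Hom B A)
    (m : Hom M A) :
  f ∘ s = id B -> is_mono m -> (exists s', m ∘ s' = s) ->
  (forall (Z : C) (k : Hom Z A), f ∘ k = zero Z B -> exists k', m ∘ k' = k) ->
  is_iso m.
Proof.
  intros fs mm [s' es] hk.
  (* Pulling back along [p] takes kernels. *)
  set (p := zero (zob C) B).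
  set (P := pullback p (f ∘ m)); set (P' := pullback p f).
  assert (e : p ∘ pb_fst P = f ∘ (m ∘ pb_snd P))
    by now rewrite pb_square, comp_assoc.
  refine (@bourn_protomodular C _ _ _ _ p (f ∘ m) s' f s m _ fs _ es
            P P' (pb_pair P' e) _ _ _); trivial.
  - now rewrite <- comp_assoc, es.
  - apply pb_pair_fst.
  - apply pb_pair_snd.
  - destruct (hk _ (pb_snd P')) as [k ek].
    { rewrite <- pb_square; apply zero_comp. }
    assert (e' : p ∘ pb_fst P' = f ∘ m ∘ k)
      by now rewrite <- comp_assoc, ek, pb_square.
    exists (pb_pair P e'); split; apply pb_ext; try apply to_zob.
    + apply mm.
      rewrite (comp_assoc (pb_snd P)), pb_pair_snd, (comp_assoc m), ek.
      now rewrite pb_pair_snd, comp_id_r.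
    + rewrite comp_assoc, pb_pair_snd, <- comp_assoc, pb_pair_snd, ek.
      now rewrite comp_id_r.
Qed.

(** If a family of maps factors only through invertible monomorphisms, then it
    is jointly epic: apply the former to the equalizer of a parallel pair. *)
Lemma equalizer_exists (A D : C) (u v : Hom A D) :
  exists (M : C) (m : Hom M A), is_mono m /\ u ∘ m = v ∘ m /\
    forall (Z : C) (k : Hom Z A), u ∘ k = v ∘ k -> exists k', m ∘ k' = k.
Proof.
  set (P := pullback (pair (id A) u) (pair (id A) v)).
  assert (e1 : pb_fst P = pb_snd P).
  { generalize (f_equal (fun h => fst A D ∘ h) (pb_square P)); cbn beta; cat.
    trivial. }
  assert (e2 : u ∘ pb_fst P = v ∘ pb_snd P).
  { generalize (f_equal (fun h => snd A D ∘ h) (pb_square P)); cbn beta; cat.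
    trivial. }
  (* The equalizer is the intersection of the two graphs. *)
  exists (pb_ob P), (pb_fst P); split; [|split].
  - intros X a b e; apply pb_ext; [exact e | now rewrite <- e1].
  - now rewrite e1 at 2.
  - intros Z k e.
    assert (e' : pair (id A) u ∘ k = pair (id A) v ∘ k)
      by (apply prod_ext; cat; trivial).
    exists (pb_pair P e'); apply pb_pair_fst.
Qed.

Lemma split_point_jointly_epic (A B D : C) (f : Hom A B) (s : Hom B A)
    (u v : Hom A D) :
  f ∘ s = id B -> u ∘ s = v ∘ s ->
  (forall (Z : C) (k : Hom Z A), f ∘ k = zero Z B -> u ∘ k = v ∘ k) ->
  u = v.
Proof.
  intros fs es ek.
  destruct (equalizer_exists u v) as (M & m & mm & em & lift).
  destruct (split_point_generated fs mm) as [g [_ mg]].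
  - now apply lift.
  - intros Z k e; now apply lift, ek.
  - now rewrite <- (comp_id_r u), <- (comp_id_r v), <- mg, !comp_assoc, em.
Qed.

(** The projection [X x Y -> X] is split by [<1,0>] and has kernel [<0,1>]. *)
Lemma prod_generated (X Y M : C) (m : Hom M (prod X Y)) :
  is_mono m ->
  (exists a, m ∘ a = pair (id X) (zero X Y)) ->
  (exists b, m ∘ b = pair (zero Y X) (id Y)) ->
  is_iso m.
Proof.
  intros mm ha [b eb].
  refine (split_point_generated (fst_pair _ _) mm ha _).
  intros Z k e; exists (b ∘ (snd X Y ∘ k)).
  rewrite comp_assoc, eb; apply prod_ext; cat; now rewrite ?e.
Qed.

Lemma prod_jointly_epic (X Y D : C) (u v : Hom (prod X Y) D) :
  u ∘ pair (id X) (zero X Y) = v ∘ pair (id X) (zero X Y) ->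
  u ∘ pair (zero Y X) (id Y) = v ∘ pair (zero Y X) (id Y) ->
  u = v.
Proof.
  intros e1 e2.
  refine (split_point_jointly_epic (fst_pair _ _) e1 _).
  intros Z k e.
  assert (ek : k = pair (zero Y X) (id Y) ∘ (snd X Y ∘ k))
    by (apply prod_ext; cat; now rewrite ?e).
  now rewrite ek, !comp_assoc, e2.
Qed.

(** * Regular images *)

Definition coim (A B : C) (f : Hom A B) : Hom A (im_ob f) :=
  coeq_map (kernel_pair_coequalizer f).

Lemma im_coim (A B : C) (f : Hom A B) : im f ∘ coim f = f.
Proof. apply coeq_desc_map. Qed.

Lemma coim_identifies (Z A B : C) (f : Hom A B) (a b : Hom Z A) :
  f ∘ a = f ∘ b -> coim f ∘ a = coim f ∘ b.
Proof.
  intro e.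
  transitivity (coim f ∘ (pb_fst (pullback f f) ∘ pb_pair (pullback f f) e)).
  - now rewrite pb_pair_fst.
  - transitivity (coim f ∘ (pb_snd (pullback f f) ∘ pb_pair (pullback f f) e)).
    + rewrite !comp_assoc; f_equal; apply coeq_eq.
    + now rewrite pb_pair_snd.
Qed.

Lemma coim_desc (A B D : C) (f : Hom A B) (h : Hom A D) :
  h ∘ pb_fst (pullback f f) = h ∘ pb_snd (pullback f f) ->
  exists k : Hom (im_ob f) D, k ∘ coim f = h.
Proof.
  intro e; exists (coeq_desc (kernel_pair_coequalizer f) e).
  apply coeq_desc_map.
Qed.

Lemma regular_epi_epic (A Q D : C) (q : Hom A Q) (u v : Hom Q D) :
  is_regular_epi q -> u ∘ q = v ∘ q -> u = v.
Proof.
  intros (Z & f & g & eq & univ) e.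
  destruct (univ D (v ∘ q)) as (k & _ & uniq).
  - now rewrite <- !comp_assoc, eq.
  - now rewrite <- (uniq u e), <- (uniq v eq_refl).
Qed.

Lemma coim_regular_epi (A B : C) (f : Hom A B) : is_regular_epi (coim f).
Proof.
  exists _, (pb_fst (pullback f f)), (pb_snd (pullback f f)); split.
  - apply coeq_eq.
  - intros X h e; exists (coeq_desc (kernel_pair_coequalizer f) e); split.
    + apply coeq_desc_map.
    + intros k ek; symmetry; now apply coeq_desc_uniq.
Qed.

Lemma coim_epic (A B D : C) (f : Hom A B) (u v : Hom (im_ob f) D) :
  u ∘ coim f = v ∘ coim f -> u = v.
Proof. exact (regular_epi_epic (coim_regular_epi f)). Qed.

(** Two generalized elements of the image identified by [im f] lift, after
    covering their domain by pulled-back regular epimorphisms, to elements of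
    the domain of [f] with the same value under [f]; the coimage already
    identifies those. *)
Lemma im_mono (A B : C) (f : Hom A B) : is_mono (im f).
Proof.
  intros X u v e.
  set (P := pullback (coim f) u).
  set (P' := pullback (coim f) (v ∘ pb_snd P)).
  assert (eP := pb_square P); assert (eP' := pb_square P').
  apply (regular_epi_epic (regular_epis_stable P (coim_regular_epi f))).
  apply (regular_epi_epic (regular_epis_stable P' (coim_regular_epi f))).
  rewrite <- eP', <- eP, <- comp_assoc.
  assert (ef : f ∘ (pb_fst P ∘ pb_snd P') = f ∘ pb_fst P').
  { transitivity (im f ∘ coim f ∘ (pb_fst P ∘ pb_snd P')).
    - now rewrite im_coim.
    - transitivity (im f ∘ coim f ∘ pb_fst P').
      + rewrite <- !comp_assoc, eP', (comp_assoc (coim f)), eP.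
        now rewrite !comp_assoc, e.
      + now rewrite im_coim. }
  now apply coim_identifies.
Qed.

(** * Extremal epimorphisms are cokernels of their kernels *)

Definition extremal_epi (A E : C) (c : Hom A E) : Prop :=
  forall (M : C) (m : Hom M E) (t : Hom A M), is_mono m -> m ∘ t = c -> is_iso m.

Lemma extremal_epi_epic (A E D : C) (c : Hom A E) (u v : Hom E D) :
  extremal_epi c -> u ∘ c = v ∘ c -> u = v.
Proof.
  intros hc e.
  destruct (equalizer_exists u v) as (M & m & mm & em & lift).
  destruct (lift _ c e) as [t et]; destruct (hc _ m t mm et) as [g [_ mg]].
  now rewrite <- (comp_id_r u), <- (comp_id_r v), <- mg, !comp_assoc, em.
Qed.

(** Pulling [m] back along [a] gives a monomorphism through which [c]
    factors. *)
Lemma extremal_epi_strong (A E B M : C) (c : Hom A E) (a : Hom E B)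
    (m : Hom M B) (t : Hom A M) :
  extremal_epi c -> is_mono m -> m ∘ t = a ∘ c -> exists t', m ∘ t' = a.
Proof.
  intros hc mm e.
  destruct (hc _ (pb_snd (pullback m a)) (pb_pair (pullback m a) e))
    as [g [_ eg]].
  - intros X u v euv; apply pb_ext; trivial.
    apply mm; now rewrite !comp_assoc, pb_square, <- !comp_assoc, euv.
  - apply pb_pair_snd.
  - exists (pb_fst (pullback m a) ∘ g).
    now rewrite comp_assoc, pb_square, <- comp_assoc, eg, comp_id_r.
Qed.

Lemma coim_extremal_epi (A B : C) (f : Hom A B) : extremal_epi (coim f).
Proof.
  intros M m t mm e.
  assert (et : t ∘ pb_fst (pullback f f) = t ∘ pb_snd (pullback f f)).
  { apply mm; rewrite !comp_assoc, e; apply coeq_eq. }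
  assert (section : exists g, m ∘ g = id (im_ob f)).
  { destruct (coim_desc et) as [g eg]; exists g.
    apply coim_epic; now rewrite <- comp_assoc, eg, comp_id_l. }
  destruct section as [g mg]; exists g; split; trivial.
  apply mm; now rewrite comp_assoc, mg, comp_id_l, comp_id_r.
Qed.

(** Quantifying over all [k] rather than using [ker c] keeps kernel objects out
    of the many changes of codomain below. *)
Definition vanishes_on_kernel (A B D : C) (d : Hom A D) (c : Hom A B) : Prop :=
  forall (Z : C) (k : Hom Z A), c ∘ k = zero Z B -> d ∘ k = zero Z D.

Lemma vanishes_on_kernel_ker (A B D : C) (d : Hom A D) (c : Hom A B) :
  vanishes_on_kernel d c <-> d ∘ ker c = zero (ker_ob c) D.
Proof.
  split.
  - intro h; apply h, ker_comp.
  - intros h Z k e; destruct (ker_lift e) as [k' <-].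
    now rewrite comp_assoc, h, zero_comp.
Qed.

(** The kernel pair of [c] is a point over [A], split by the diagonal and with
    kernel [Ker c]; a morphism vanishing on [Ker c] thus coequalizes the kernel
    pair and factors through the coimage of [c], which is [c] itself up to
    isomorphism as [c] is extremal. *)
Lemma factors_through_extremal_epi (A E D : C) (c : Hom A E) (d : Hom A D) :
  extremal_epi c ->
  (vanishes_on_kernel d c <-> exists phi : Hom E D, phi ∘ c = d).
Proof.
  intro hc; split.
  - intro hd.
    destruct (hc _ _ _ (im_mono (f := c)) (im_coim c)) as [g [gi _]].
    assert (e : d ∘ pb_fst (pullback c c) = d ∘ pb_snd (pullback c c)).
    { refine (split_point_jointly_epic
        (pb_pair_fst (pullback c c) (eq_refl (c ∘ id A))) _ _).
      - now rewrite <- !comp_assoc, pb_pair_fst, pb_pair_snd.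
      - intros Z k ek.
        rewrite <- !comp_assoc, ek, comp_zero; symmetry; apply hd.
        now rewrite comp_assoc, <- pb_square, <- comp_assoc, ek, comp_zero. }
    destruct (coim_desc e) as [k ek].
    exists (k ∘ g).
    assert (gc : g ∘ c = coim c).
    { transitivity (g ∘ (im c ∘ coim c)).
      - now rewrite im_coim.
      - now rewrite comp_assoc, gi, comp_id_l. }
    now rewrite <- comp_assoc, gc.
  - intros [phi <-] Z k e; now rewrite <- comp_assoc, e, comp_zero.
Qed.

(** * Huq-commutation *)

Lemma cross2_extremal_epi (X Y : C) : extremal_epi (cross2_map X Y).
Proof.
  intros M m t mm e; apply (prod_generated mm).
  - exists (t ∘ inl X Y); rewrite comp_assoc, e; unfold cross2_map.
    apply prod_ext; cat; trivial.
  - exists (t ∘ inr X Y); rewrite comp_assoc, e; unfold cross2_map.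
    apply prod_ext; cat; trivial.
Qed.

Lemma huq_commute_vanishes (X Y D : C) (x : Hom X D) (y : Hom Y D) :
  huq_commute x y <-> vanishes_on_kernel (copair x y) (cross2_map X Y).
Proof.
  rewrite (factors_through_extremal_epi _ (@cross2_extremal_epi X Y)).
  assert (el : cross2_map X Y ∘ inl X Y = pair (id X) (zero X Y))
    by (apply prod_ext; unfold cross2_map; cat; trivial).
  assert (er : cross2_map X Y ∘ inr X Y = pair (zero Y X) (id Y))
    by (apply prod_ext; unfold cross2_map; cat; trivial).
  split; intros [phi h]; exists phi.
  - destruct h as [hx hy].
    apply coprod_ext; cat; now rewrite ?el, ?er.
  - rewrite <- el, <- er, !comp_assoc, h; cat; split; trivial.
Qed.

(** The map [p x q] is extremal since the product is generated by its two
    factors, and its kernel is [Ker p x Ker q].  The morphism witnessing that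
    [x ∘ p] and [y ∘ q] commute is zero on [Ker p] and on [Ker q], hence on
    their product, so it descends along [p x q]. *)
Lemma huq_commute_precomp (X Y X' Y' D : C) (p : Hom X X') (q : Hom Y Y')
    (x : Hom X' D) (y : Hom Y' D) :
  extremal_epi p -> extremal_epi q ->
  huq_commute (x ∘ p) (y ∘ q) -> huq_commute x y.
Proof.
  intros hp hq [phi [ex ey]].
  set (pq := pair (p ∘ fst X Y) (q ∘ snd X Y)).
  assert (el : pq ∘ pair (id X) (zero X Y) = pair (id X') (zero X' Y') ∘ p)
    by (apply prod_ext; unfold pq; cat; trivial).
  assert (er : pq ∘ pair (zero Y X) (id Y) = pair (zero Y' X') (id Y') ∘ q)
    by (apply prod_ext; unfold pq; cat; trivial).
  assert (hpq : extremal_epi pq).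
  { intros M m t mm e; apply (prod_generated mm).
    - apply (extremal_epi_strong (t := t ∘ pair (id X) (zero X Y)) hp mm).
      now rewrite comp_assoc, e.
    - apply (extremal_epi_strong (t := t ∘ pair (zero Y X) (id Y)) hq mm).
      now rewrite comp_assoc, e. }
  destruct (proj1 (factors_through_extremal_epi phi hpq)) as [psi epsi].
  - intros Z k e; apply pair_comp_zero in e; destruct e as [e1 e2].
    rewrite <- comp_assoc in e1, e2.
    destruct (ker_lift e1) as [k1 ek1]; destruct (ker_lift e2) as [k2 ek2].
    set (kk := pair (ker p ∘ fst (ker_ob p) (ker_ob q))
                    (ker q ∘ snd (ker_ob p) (ker_ob q))).
    assert (ek : k = kk ∘ pair k1 k2)
      by (unfold kk; apply prod_ext; cat; now symmetry).
    assert (z : phi ∘ kk = zero _ D).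
    { apply prod_jointly_epic.
      - transitivity (phi ∘ (pair (id X) (zero X Y) ∘ ker p)).
        + rewrite <- comp_assoc; f_equal; unfold kk; apply prod_ext; cat; trivial.
        + rewrite comp_assoc, ex, <- comp_assoc, ker_comp; cat; trivial.
      - transitivity (phi ∘ (pair (zero Y X) (id Y) ∘ ker q)).
        + rewrite <- comp_assoc; f_equal; unfold kk; apply prod_ext; cat; trivial.
        + rewrite comp_assoc, ey, <- comp_assoc, ker_comp; cat; trivial. }
    now rewrite ek, comp_assoc, z, zero_comp.
  - exists psi; split.
    + apply (extremal_epi_epic hp).
      now rewrite <- comp_assoc, <- el, comp_assoc, epsi.
    + apply (extremal_epi_epic hq).
      now rewrite <- comp_assoc, <- er, comp_assoc, epsi.
Qed.

(** * The weighted pullback as a quotient of a ternary sum *)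

Lemma retr_in (W Z : C) :
  retr W Z ∘ inl W Z = id W /\ retr W Z ∘ inr W Z = zero Z W.
Proof. unfold retr; cat; split; trivial. Qed.

Lemma weighted_fst_e1 (W X Y : C) :
  pb_fst (weighted_pb W X Y) ∘ weighted_e1 W X Y = id (coprod W X).
Proof. apply pb_pair_fst. Qed.

Lemma weighted_snd_e1 (W X Y : C) :
  pb_snd (weighted_pb W X Y) ∘ weighted_e1 W X Y = inl W Y ∘ retr W X.
Proof. apply pb_pair_snd. Qed.

Lemma weighted_fst_e2 (W X Y : C) :
  pb_fst (weighted_pb W X Y) ∘ weighted_e2 W X Y = inl W X ∘ retr W Y.
Proof. apply pb_pair_fst. Qed.

Lemma weighted_snd_e2 (W X Y : C) :
  pb_snd (weighted_pb W X Y) ∘ weighted_e2 W X Y = id (coprod W Y).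
Proof. apply pb_pair_snd. Qed.

Lemma weighted_e1_e2_inl (W X Y : C) :
  weighted_e1 W X Y ∘ inl W X = weighted_e2 W X Y ∘ inl W Y.
Proof.
  destruct (retr_in W X) as [rx _]; destruct (retr_in W Y) as [ry _].
  apply pb_ext; rewrite !comp_assoc.
  - rewrite weighted_fst_e1, weighted_fst_e2, <- comp_assoc, ry; cat; trivial.
  - rewrite weighted_snd_e1, weighted_snd_e2, <- comp_assoc, rx; cat; trivial.
Qed.

(** The two maps [e1] and [e2] agree on [W] ([weighted_e1_e2_inl]), so a
    morphism on the weighted pullback restricting to [<w;x>] and [<w;y>] is the
    same as a factorization of [<x;y;w>] through this map. *)
Definition weighted_map (X Y W : C) :
    Hom (coprod3 X Y W) (pb_ob (weighted_pb W X Y)) :=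
  copair3 (weighted_e1 W X Y ∘ inr W X) (weighted_e2 W X Y ∘ inr W Y)
    (weighted_e1 W X Y ∘ inl W X).

Lemma weighted_map_e1 (X Y W : C) :
  weighted_map X Y W ∘ copair (inr (coprod X Y) W) (inl (coprod X Y) W ∘ inl X Y)
  = weighted_e1 W X Y.
Proof. apply coprod_ext; unfold weighted_map; cat; trivial. Qed.

Lemma weighted_map_e2 (X Y W : C) :
  weighted_map X Y W ∘ copair (inr (coprod X Y) W) (inl (coprod X Y) W ∘ inr X Y)
  = weighted_e2 W X Y.
Proof.
  apply coprod_ext; unfold weighted_map; cat; trivial.
  apply weighted_e1_e2_inl.
Qed.

(** The first projection is split by [e1], and an element of its kernel is the
    image under [e2] of its second component. *)
Lemma weighted_map_extremal_epi (X Y W : C) : extremal_epi (weighted_map X Y W).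
Proof.
  intros M m t mm e.
  refine (split_point_generated (weighted_fst_e1 W X Y) mm _ _).
  - eexists; rewrite <- weighted_map_e1, <- e, <- comp_assoc; reflexivity.
  - intros Z k ek; eexists.
    transitivity (weighted_e2 W X Y ∘ (pb_snd (weighted_pb W X Y) ∘ k)).
    + rewrite <- weighted_map_e2, <- e, <- !comp_assoc; reflexivity.
    + apply pb_ext; rewrite !comp_assoc.
      * rewrite weighted_fst_e2, <- (comp_assoc _ (retr W Y)), <- pb_square.
        now rewrite <- !comp_assoc, ek, !comp_zero.
      * now rewrite weighted_snd_e2, comp_id_l.
Qed.

Lemma commute_over_vanishes (X Y W D : C) (x : Hom X D) (y : Hom Y D)
    (w : Hom W D) :
  commute_over x y w <->
  vanishes_on_kernel (copair3 x y w) (weighted_map X Y W).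
Proof.
  rewrite (factors_through_extremal_epi _ (@weighted_map_extremal_epi X Y W)).
  split; intros [phi h]; exists phi.
  - destruct h as [h1 h2].
    assert (e1 := f_equal (fun h => h ∘ inl W X) h1).
    assert (e2 := f_equal (fun h => h ∘ inr W X) h1).
    assert (e3 := f_equal (fun h => h ∘ inr W Y) h2).
    revert e1 e2 e3; cbn beta; unfold weighted_map; cat; intros.
    repeat apply coprod_ext; cat; assumption.
  - rewrite <- weighted_map_e1, <- weighted_map_e2, !comp_assoc, h.
    split; apply coprod_ext; cat; trivial.
Qed.

(** * Decomposition of the kernel of the weighted map *)

Definition drop3 (X Y W : C) : Hom (coprod3 X Y W) (coprod X Y) :=
  copair3 (inl X Y) (inr X Y) (zero W (coprod X Y)).
Definition drop2 (X Y W : C) : Hom (coprod3 X Y W) (coprod X W) :=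
  copair3 (inl X W) (zero Y (coprod X W)) (inr X W).
Definition drop1 (X Y W : C) : Hom (coprod3 X Y W) (coprod Y W) :=
  copair3 (zero X (coprod Y W)) (inl Y W) (inr Y W).

Lemma cross3_map_comp_zero (Z X Y W : C) (k : Hom Z (coprod3 X Y W)) :
  cross3_map X Y W ∘ k = zero Z _ <->
  (drop3 X Y W ∘ k = zero Z _ /\ drop2 X Y W ∘ k = zero Z _) /\
  drop1 X Y W ∘ k = zero Z _.
Proof. unfold cross3_map; now rewrite !pair_comp_zero. Qed.

Definition swap (A B : C) : Hom (coprod A B) (coprod B A) :=
  copair (inr B A) (inl B A).

Lemma swap_comp_zero (Z A B : C) (k : Hom Z (coprod A B)) :
  swap A B ∘ k = zero Z _ <-> k = zero Z _.
Proof.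
  split; intro e.
  - assert (inv : swap B A ∘ swap A B = id _)
      by (apply coprod_ext; unfold swap; cat; trivial).
    now rewrite <- (comp_id_l k), <- inv, <- comp_assoc, e, comp_zero.
  - now rewrite e, comp_zero.
Qed.

(** The weighted pullback sits inside [(W + X) x (W + Y)], and its projections
    are the maps omitting [Y] and [X] up to the order of the summands. *)
Lemma weighted_map_comp_zero (Z X Y W : C) (k : Hom Z (coprod3 X Y W)) :
  weighted_map X Y W ∘ k = zero Z _ <->
  drop2 X Y W ∘ k = zero Z _ /\ drop1 X Y W ∘ k = zero Z _.
Proof.
  destruct (retr_in W X) as [rx rx0]; destruct (retr_in W Y) as [ry ry0].
  assert (e1 : pb_fst (weighted_pb W X Y) ∘ weighted_map X Y W
               = swap X W ∘ drop2 X Y W).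
  { repeat apply coprod_ext; unfold weighted_map, swap, drop2; cat;
      rewrite comp_assoc, ?weighted_fst_e1, ?weighted_fst_e2; cat; trivial.
    rewrite ry0; cat; trivial. }
  assert (e2 : pb_snd (weighted_pb W X Y) ∘ weighted_map X Y W
               = swap Y W ∘ drop1 X Y W).
  { repeat apply coprod_ext; unfold weighted_map, swap, drop1; cat;
      rewrite comp_assoc, ?weighted_snd_e1, ?weighted_snd_e2; cat;
      rewrite ?rx0, ?rx; cat; trivial. }
  rewrite <- (swap_comp_zero (drop2 X Y W ∘ k)),
    <- (swap_comp_zero (drop1 X Y W ∘ k)), !comp_assoc, <- e1, <- e2,
    <- !comp_assoc.
  split.
  - intro e; rewrite e; split; apply comp_zero.
  - intros [h1 h2]; apply pb_ext; now rewrite comp_zero.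
Qed.

Lemma cross2_map_comp_zero (Z X Y : C) (k : Hom Z (coprod X Y)) :
  cross2_map X Y ∘ k = zero Z _ <->
  copair (id X) (zero Y X) ∘ k = zero Z X /\
  copair (zero X Y) (id Y) ∘ k = zero Z Y.
Proof. apply pair_comp_zero. Qed.

(** The split extension [X <> Y <> W -> Ker c -> X <> Y], with [c] the weighted
    map, shows that vanishing on [Ker c] can be tested on the two ends. *)
Lemma commute_over_iff (X Y W D : C) (x : Hom X D) (y : Hom Y D)
    (w : Hom W D) :
  commute_over x y w <->
  huq_commute x y /\ vanishes_on_kernel (copair3 x y w) (cross3_map X Y W).
Proof.
  rewrite commute_over_vanishes, huq_commute_vanishes.
  pose (i := inl (coprod X Y) W : Hom (coprod X Y) (coprod3 X Y W)).
  assert (di : copair3 x y w ∘ i = copair x y)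
    by (unfold i; cat; trivial).
  assert (hi : forall Z (k : Hom Z (coprod X Y)),
    cross2_map X Y ∘ k = zero Z _ -> weighted_map X Y W ∘ (i ∘ k) = zero Z _).
  { intros Z k e; apply cross2_map_comp_zero in e; destruct e as [ex ey].
    apply weighted_map_comp_zero; rewrite !comp_assoc.
    assert (e2 : drop2 X Y W ∘ i = inl X W ∘ copair (id X) (zero Y X))
      by (apply coprod_ext; unfold i, drop2; cat; trivial).
    assert (e1 : drop1 X Y W ∘ i = inl Y W ∘ copair (zero X Y) (id Y))
      by (apply coprod_ext; unfold i, drop1; cat; trivial).
    rewrite e1, e2, <- !comp_assoc, ex, ey; split; apply comp_zero. }
  split.
  - intro h; split.
    + intros Z k e; rewrite <- di, <- comp_assoc; now apply h, hi.
    + intros Z k e; apply h; apply weighted_map_comp_zero.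
      now apply cross3_map_comp_zero in e.
  - intros [h2 h3]; apply vanishes_on_kernel_ker.
    (* [f] omits the summand [W] and [s] is induced by the inclusion [i]; they
       form a point with kernel [X <> Y <> W]. *)
    set (kap := ker (weighted_map X Y W)).
    assert (ekap : weighted_map X Y W ∘ kap = zero _ _) by apply ker_comp.
    assert (dkap := ekap); apply weighted_map_comp_zero in dkap.
    destruct dkap as [d2 d1].
    destruct (ker_lift (f := cross2_map X Y) (k := drop3 X Y W ∘ kap))
      as [f ef].
    { apply cross2_map_comp_zero; rewrite !comp_assoc.
      assert (e1 : copair (id X) (zero Y X) ∘ drop3 X Y W =
                   copair (id X) (zero W X) ∘ drop2 X Y W)
        by (repeat apply coprod_ext; unfold drop2, drop3; cat; trivial).
      assert (e2 : copair (zero X Y) (id Y) ∘ drop3 X Y W =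
                   copair (id Y) (zero W Y) ∘ drop1 X Y W)
        by (repeat apply coprod_ext; unfold drop1, drop3; cat; trivial).
      rewrite e1, e2, <- !comp_assoc, d1, d2; split; apply comp_zero. }
    destruct (ker_lift (hi _ _ (ker_comp (cross2_map X Y)))) as [s es].
    fold kap in es.
    apply (split_point_jointly_epic (f := f) (s := s)).
    + apply (ker_mono (f := cross2_map X Y)).
      rewrite comp_assoc, ef, <- comp_assoc, es, comp_assoc, comp_id_r.
      assert (e : drop3 X Y W ∘ i = id _)
        by (apply coprod_ext; unfold i, drop3; cat; trivial).
      now rewrite e, comp_id_l.
    + rewrite <- comp_assoc, es, comp_assoc, di, zero_comp.
      apply h2, ker_comp.
    + intros Z k ek; rewrite zero_comp, <- comp_assoc; apply h3.
      apply cross3_map_comp_zero; rewrite !comp_assoc, d1, d2, !zero_comp.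
      now rewrite <- ef, <- comp_assoc, ek, comp_zero.
Qed.

(** * Images, the zero weight and Higgins commutators *)

Lemma cross3_natural (X Y W X' Y' W' D : C) (p : Hom X X') (q : Hom Y Y')
    (r : Hom W W') (x : Hom X' D) (y : Hom Y' D) (w : Hom W' D) :
  vanishes_on_kernel (copair3 x y w) (cross3_map X' Y' W') ->
  vanishes_on_kernel (copair3 (x ∘ p) (y ∘ q) (w ∘ r)) (cross3_map X Y W).
Proof.
  intros h Z k e; apply cross3_map_comp_zero in e; destruct e as [[e3 e2] e1].
  set (t := copair3 (inl (coprod X' Y') W' ∘ (inl X' Y' ∘ p))
    (inl (coprod X' Y') W' ∘ (inr X' Y' ∘ q)) (inr (coprod X' Y') W' ∘ r)).
  assert (dt : copair3 (x ∘ p) (y ∘ q) (w ∘ r) = copair3 x y w ∘ t)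
    by (repeat apply coprod_ext; unfold t; cat; trivial).
  rewrite dt, <- comp_assoc; apply h.
  apply cross3_map_comp_zero; rewrite !comp_assoc.
  assert (t3 : drop3 X' Y' W' ∘ t =
    copair (inl X' Y' ∘ p) (inr X' Y' ∘ q) ∘ drop3 X Y W)
    by (repeat apply coprod_ext; unfold t, drop3; cat; trivial).
  assert (t2 : drop2 X' Y' W' ∘ t =
    copair (inl X' W' ∘ p) (inr X' W' ∘ r) ∘ drop2 X Y W)
    by (repeat apply coprod_ext; unfold t, drop2; cat; trivial).
  assert (t1 : drop1 X' Y' W' ∘ t =
    copair (inl Y' W' ∘ q) (inr Y' W' ∘ r) ∘ drop1 X Y W)
    by (repeat apply coprod_ext; unfold t, drop1; cat; trivial).
  now rewrite t1, t2, t3, <- !comp_assoc, e1, e2, e3, !comp_zero.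
Qed.

Lemma huq_commute_comp (X Y X' Y' D : C) (p : Hom X X') (q : Hom Y Y')
    (x : Hom X' D) (y : Hom Y' D) :
  huq_commute x y -> huq_commute (x ∘ p) (y ∘ q).
Proof.
  intros [phi [ex ey]].
  exists (phi ∘ pair (p ∘ fst X Y) (q ∘ snd X Y)).
  rewrite <- ex, <- ey, <- !comp_assoc.
  split; f_equal; apply prod_ext; cat; trivial.
Qed.

Lemma huq_commute_im (X Y D : C) (x : Hom X D) (y : Hom Y D) :
  huq_commute x y <-> huq_commute (im x) (im y).
Proof.
  split; intro h.
  - apply (huq_commute_precomp (coim_extremal_epi (f := x))
             (coim_extremal_epi (f := y))).
    now rewrite !im_coim.
  - rewrite <- (im_coim x), <- (im_coim y); now apply huq_commute_comp.
Qed.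

(** With the zero weight, omitting the summand [0] is an isomorphism, so the
    ternary co-smash product is trivial. *)
Lemma huq_commute_over_zero (X Y D : C) (x : Hom X D) (y : Hom Y D) :
  huq_commute x y -> commute_over x y (zero (zob C) D).
Proof.
  intro h; apply commute_over_iff; split; trivial.
  intros Z k e; apply cross3_map_comp_zero in e; destruct e as [[e _] _].
  assert (inv : inl (coprod X Y) (zob C) ∘ drop3 X Y (zob C) = id _).
  { repeat apply coprod_ext; unfold drop3; cat; trivial.
    apply from_zob. }
  now rewrite <- (comp_id_l k), <- inv, <- (comp_assoc _ _ k), e, !comp_zero.
Qed.

Lemma is_zero_subobject_im (A D : C) (g : Hom A D) :
  is_zero_subobject (im g) <-> g = zero A D.
Proof.
  split.
  - intros (h & _ & e).
    now rewrite <- (im_coim g), <- e, !zero_comp.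
  - intro e.
    assert (z : im g = zero _ D)
      by (apply coim_epic; now rewrite im_coim, zero_comp).
    exists (zero _ _); split.
    + exists (zero _ _); split; [| apply to_zob].
      apply (im_mono (f := g)); now rewrite z, !zero_comp.
    + now rewrite zero_comp.
Qed.

Lemma higgins2_zero (X Y D : C) (x : Hom X D) (y : Hom Y D) :
  is_zero_subobject (higgins2 x y) <-> huq_commute x y.
Proof.
  unfold higgins2.
  now rewrite is_zero_subobject_im, huq_commute_vanishes, vanishes_on_kernel_ker.
Qed.

Lemma higgins3_zero (X Y W D : C) (x : Hom X D) (y : Hom Y D) (w : Hom W D) :
  is_zero_subobject (higgins3 x y w) <->
  vanishes_on_kernel (copair3 x y w) (cross3_map X Y W).
Proof.
  unfold higgins3.
  now rewrite is_zero_subobject_im, vanishes_on_kernel_ker.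
Qed.

(** * Comparison of the three conditions *)

(** The zero weight mediates: over it, commuting is Huq-commuting. *)
Lemma huq_implies_iff_weight_independent (P : cospan_class C) :
  huq_implies_commute_over P <-> commute_over_weight_independent P.
Proof.
  split.
  - intros h X Y D x y Pxy W W' w w'.
    split; intro c; apply h; trivial; now apply commute_over_iff in c.
  - intros h X Y W D x y w Pxy c.
    apply (h _ _ _ x y Pxy _ _ (zero (zob C) D) w).
    now apply huq_commute_over_zero.
Qed.

(** Stated for any class of cospans closed under images, so that it serves both
    arbitrary cospans and cospans of monomorphisms. *)
Lemma huq_implies_iff_binary_ternary (P : cospan_class C) :
  (forall X Y D (x : Hom X D) (y : Hom Y D), P _ _ _ x y ->
     P _ _ _ (im x) (im y)) ->
  huq_implies_commute_over P <-> binary_zero_implies_ternary_zero P.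
Proof.
  intro Pim; split.
  - intros h X Y W D x y w Pxy b.
    apply higgins3_zero.
    apply (commute_over_iff (im x) (im y) (im w)), h; [now apply Pim |].
    now apply higgins2_zero.
  - intros h X Y W D x y w Pxy c.
    apply commute_over_iff; split; trivial.
    rewrite <- (im_coim x), <- (im_coim y), <- (im_coim w).
    apply cross3_natural, higgins3_zero, h; trivial.
    now apply higgins2_zero, (huq_commute_im x y).
Qed.

(** Apply the condition for monomorphisms to the images of [x] and [y], with
    the same weight. *)
Lemma huq_implies_all_iff_mono :
  huq_implies_commute_over (all_cospans C) <->
  huq_implies_commute_over (mono_cospans C).
Proof.
  split.
  - intros h X Y W D x y w _; now apply h.
  - intros h X Y W D x y w _ c.
    apply commute_over_iff; split; trivial.
    rewrite <- (im_coim x), <- (im_coim y), <- (comp_id_r w).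
    apply cross3_natural, commute_over_iff, h.
    + split; apply im_mono.
    + now apply (huq_commute_im x y).
Qed.

End SemiAbelianTheory.

Theorem proposition4p1 (C : SemiAbelianCategory) :
  (huq_implies_commute_over (all_cospans C) <->
   commute_over_weight_independent (all_cospans C)) /\
  (commute_over_weight_independent (all_cospans C) <->
   binary_zero_implies_ternary_zero (all_cospans C)) /\
  (binary_zero_implies_ternary_zero (all_cospans C) <->
   huq_implies_commute_over (mono_cospans C)) /\
  (huq_implies_commute_over (mono_cospans C) <->
   commute_over_weight_independent (mono_cospans C)) /\
  (commute_over_weight_independent (mono_cospans C) <->
   binary_zero_implies_ternary_zero (mono_cospans C)).
Proof.
  assert (all_im := @huq_implies_iff_binary_ternary C (all_cospans C)
                      (fun _ _ _ _ _ _ => I)).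
  assert (mono_im := @huq_implies_iff_binary_ternary C (mono_cospans C)
                      (fun _ _ _ _ _ _ => conj (im_mono (f := _)) (im_mono (f := _)))).
  assert (all_wt := huq_implies_iff_weight_independent (all_cospans C)).
  assert (mono_wt := huq_implies_iff_weight_independent (mono_cospans C)).
  assert (all_mono := huq_implies_all_iff_mono C).
  tauto.
Qed.
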